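(* Let $\mathfrak{H}_1,\mathfrak{H}_2,\mathfrak{K}$ be Hilbert spaces and let $R_i\subseteq\mathfrak{H}_i\times\mathfrak{K}$, $i\in\{1,2\}$, be operators. If the row $\begin{pmatrix}R_1 & R_2\end{pmatrix}$ is closable, then $R_1$ and $R_2$ are closable. Conversely, if $\operatorname{dom}R_1^*+\operatorname{dom}R_2^*$ is closed and $R_1$ and $R_2$ are closable, then $\begin{pmatrix}R_1 & R_2\end{pmatrix}$ is closable.
   Context: A linear relation from a Hilbert space $X$ to a Hilbert space $Y$ is a linear subspace $A\subseteq X\times Y$ (not necessarily closed); $X\times Y$ carries the Hilbert-sum inner product. Put $\operatorname{dom}A=\{x: (x,y)\in A\text{ for some }y\}$ and $\operatorname{mul}A=\{y:(0,y)\in A\}$. The adjoint is $A^*=\{(y',x')\in Y\times X: \langle x,x'\rangle_X=\langle y,y'\rangle_Y\ \text{for all }(x,y)\in A\}$ (a linear relation from $Y$ to $X$, defined even if $A$ is not densely defined). The overbar denotes the closure in $X\times Y$. An operator is a linear relation $A$ with $\operatorname{mul}A=\{0\}$ (identified with its graph; neither densely defined nor bounded in general). An operator $A$ is closable if $\overline{A}$ is an operator; a row of two operators is itself an operator. Row: for linear relations $R_i\subseteq X_i\times Y$, $i\in\{1,2\}$, $\begin{pmatrix}R_1 & R_2\end{pmatrix}:=\{((h_1,h_2),k_1+k_2): (h_1,k_1)\in R_1,\ (h_2,k_2)\in R_2\}$. This definition fails to give an operator unless both $R_i$ are operators. *)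

(* Defs.v *)
From HB Require Import structures.
From mathcomp Require Import all_boot all_order all_algebra.
From mathcomp Require Import sesquilinear complex.
From mathcomp Require Import boolp classical_sets reals topology normedtype.

Set Implicit Arguments.
Unset Strict Implicit.
Unset Printing Implicit Defensive.

Import Order.TTheory GRing.Theory Num.Theory.
Import numFieldNormedType.Exports.

Local Open Scope classical_set_scope.
Local Open Scope ring_scope.

(* Hilbert spaces are real or complex; all spaces in a statement share the same
   scalar field [scalars R k]. *)
Variant scalar_kind := RealScalars | ComplexScalars.

Definition scalars (R : realType) (k : scalar_kind) : numFieldType :=
  match k with RealScalars => R | ComplexScalars => R[i] end.

Definition scalar_conj (R : realType) (k : scalar_kind) :
    scalars R k -> scalars R k :=
  match k with
  | RealScalars => id
  | ComplexScalars => fun z : R[i] => Num.conj z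
  end.

(* [inner] is linear in its first argument and conjugate-linear in the second. *)
HB.mixin Record CompleteNormedModule_isHilbert (R : realType) (k : scalar_kind)
    V of CompleteNormedModule (scalars R k) V := {
  inner : {dot V for @scalar_conj R k} ;
  sqr_norm_inner : forall x : V, `|x| ^+ 2 = inner x x
}.

#[short(type="hilbertType")]
HB.structure Definition Hilbert (R : realType) (k : scalar_kind) :=
  {V of CompleteNormedModule (scalars R k) V
      & CompleteNormedModule_isHilbert R k V}.

Arguments inner {R k s}.
Arguments sqr_norm_inner {R k s} x.

Section LinearRelations.
Context {K : numFieldType}.

Definition linear_relation {X Y : lmodType K} (A : set (X * Y)) : Prop :=
  A 0 /\ forall (a : K) (u v : X * Y), A u -> A v -> A (a *: u + v).

Definition reldom {X Y : lmodType K} (A : set (X * Y)) : set X :=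
  [set x | exists y, A (x, y)].

Definition relmul {X Y : lmodType K} (A : set (X * Y)) : set Y :=
  [set y | A (0, y)].

Definition is_operator {X Y : lmodType K} (A : set (X * Y)) : Prop :=
  linear_relation A /\ relmul A = [set 0].

(* The norm of the library on [X * Y] is the max norm, which is not the norm of
   the Hilbert sum but induces the same topology: see [closure_hsumP] and
   [closure_hsum3P]. *)
Definition closable {X Y : normedModType K} (A : set (X * Y)) : Prop :=
  is_operator (closure A).

Definition relrow {X1 X2 Y : lmodType K} (R1 : set (X1 * Y)) (R2 : set (X2 * Y))
    : set ((X1 * X2) * Y) :=
  [set p | exists h1 h2 k1 k2,
     [/\ R1 (h1, k1), R2 (h2, k2) & p = ((h1, h2), k1 + k2)]].

End LinearRelations.

Definition adjoint {R : realType} {k : scalar_kind} {X Y : hilbertType R k}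
    (A : set (X * Y)) : set (Y * X) :=
  [set p | forall x y, A (x, y) -> inner x p.2 = inner y p.1].

Section HilbertSumTopology.
Context {R : realType} {k : scalar_kind}.

Let sqr_norm_ge0 (X : hilbertType R k) (x : X) : 0 <= `|x| ^+ 2.
Proof. exact: exprn_ge0. Qed.

Let sqr_norm_lt (X : hilbertType R k) (x : X) (e : scalars R k) : 0 < e ->
  (`|x| ^+ 2 < e ^+ 2) = (`|x| < e).
Proof. by move=> e0; rewrite ltr_pXn2r// nnegrE// ltW. Qed.

Lemma closure_hsumP {X Y : hilbertType R k} (A : set (X * Y)) (p : X * Y) :
  closure A p <-> forall e : scalars R k, 0 < e -> exists q, A q /\
    inner (q.1 - p.1) (q.1 - p.1) + inner (q.2 - p.2) (q.2 - p.2) < e ^+ 2.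
Proof.
split=> [cAp e e0|h B /nbhs_ballP[e /= e0 eB]].
  have e20 : 0 < e / 2 by rewrite divr_gt0.
  have /cAp [q [Aq]] : nbhs p (ball p (e / 2)) by apply: nbhsx_ballx.
  case; rewrite -!ball_normE /= => p1 p2; exists q; split => //.
  rewrite -!sqr_norm_inner -(distrC p.1) -(distrC p.2).
  move: p1 p2; rewrite -!sqr_norm_lt// => p1 p2.
  apply: lt_le_trans (ltrD p1 p2) _.
  rewrite exprMn exprVn -natrX -mulrDr ger_pMr ?exprn_gt0//.
  by rewrite -[_ + _]mulr2n -[_ *+ 2]mulr_natr ler_pdivrMl// mulr1 ler_nat.
have [q [Aq]] := h e e0; rewrite -!sqr_norm_inner => pq.
exists q; split => //; apply: eB; split; rewrite -ball_normE /= distrC.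
  by rewrite -sqr_norm_lt// (le_lt_trans _ pq)// lerDl sqr_norm_ge0.
by rewrite -sqr_norm_lt// (le_lt_trans _ pq)// lerDr sqr_norm_ge0.
Qed.

Lemma closure_hsum3P {X1 X2 Y : hilbertType R k} (A : set ((X1 * X2) * Y))
    (p : (X1 * X2) * Y) :
  closure A p <-> forall e : scalars R k, 0 < e -> exists q, A q /\
    inner (q.1.1 - p.1.1) (q.1.1 - p.1.1) + inner (q.1.2 - p.1.2) (q.1.2 - p.1.2)
      + inner (q.2 - p.2) (q.2 - p.2) < e ^+ 2.
Proof.
split=> [cAp e e0|h B /nbhs_ballP[e /= e0 eB]].
  have e20 : 0 < e / 2 by rewrite divr_gt0.
  have /cAp [q [Aq]] : nbhs p (ball p (e / 2)) by apply: nbhsx_ballx.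
  case=> -[]; rewrite -!ball_normE /= => p1 p2 p3; exists q; split => //.
  rewrite -!sqr_norm_inner -(distrC p.1.1) -(distrC p.1.2) -(distrC p.2).
  move: p1 p2 p3; rewrite -!sqr_norm_lt// => p1 p2 p3.
  apply: lt_le_trans (ltrD (ltrD p1 p2) p3) _.
  rewrite exprMn exprVn -natrX -!mulrDr ger_pMr ?exprn_gt0//.
  by rewrite -mulr2n -mulrSr -[_ *+ 3]mulr_natr ler_pdivrMl// mulr1 ler_nat.
have [q [Aq]] := h e e0; rewrite -!sqr_norm_inner => pq.
exists q; split => //; apply: eB; split; first split;
  rewrite -ball_normE /= distrC -sqr_norm_lt// (le_lt_trans _ pq)//.
- by rewrite -addrA lerDl addr_ge0// sqr_norm_ge0.
- by rewrite addrAC lerDr addr_ge0// sqr_norm_ge0.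
- by rewrite lerDr addr_ge0// sqr_norm_ge0.
Qed.

End HilbertSumTopology.

(* Main.v *)
Require Import Defs.
From HB Require Import structures.
From mathcomp Require Import all_boot all_order all_algebra.
From mathcomp Require Import sesquilinear complex ring.
From mathcomp Require Import boolp classical_sets reals topology normedtype.

Set Implicit Arguments.
Unset Strict Implicit.
Unset Printing Implicit Defensive.

Import Order.TTheory GRing.Theory Num.Theory.
Import numFieldNormedType.Exports.

Local Open Scope classical_set_scope.
Local Open Scope ring_scope.

(** The first implication is a restriction argument: an operator contains
    [(0, 0)], so [(h, l) |-> ((h, 0), l)] maps [R1] into the row, and a vertical
    vector [(0, y)] in the closure of [R1] gives one in the closure of the row
    ([closable_row_fst], [closable_row_snd]).

    For the converse write [D1], [D2] for the domains of the adjoints.  For a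
    linear relation [A], a vector orthogonal to [dom A*] lies in the
    multivalued part of the closure of [A] ([orth_reldom_adjoint]); this is the
    projection theorem in the Hilbert sum ([dot_separation]).  Hence [D1] and
    [D2] are dense when [R1] and [R2] are closable, and the closed space
    [D1 + D2] is the whole of [K].

    Let [((0, 0), y)] be in the closure of the row, the limit of
    [((h1 n, h2 n), k1 n + k2 n)] with [(hi n, ki n)] in [Ri].  For [(d1, x1)]
    in the adjoint of [R1] and [(d2, x2)] in that of [R2], the definition of the
    adjoint gives

      [<k1 n, d1 + d2> = <h1 n, x1> - <h2 n, x2> + <k1 n + k2 n, d2>],

    which tends to [<y, d2>].  Since [D1 + D2] is everything, [k1] is weakly
    bounded, hence bounded by some [B] ([uniform_boundedness]), and therefore
    [|<y, d2>| <= B |d1 + d2|].  As [D1] is dense, [d1] can be chosen arbitrarily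
    close to [- d2]; so [y] is orthogonal to [D2], and [y = 0] because [R2] is
    closable. *)

(** * Real and complex scalars *)

Section Scalars.
Variables (R : realType) (k : scalar_kind).
Local Notation F := (scalars R k).

Lemma scalar_conj_is_zmod_morphism : zmod_morphism (@scalar_conj R k).
Proof. by case: k => //= x y; apply: rmorphB. Qed.

Lemma scalar_conj_is_monoid_morphism : monoid_morphism (@scalar_conj R k).
Proof. by case: k; split=> //= [|x y]; [exact: rmorph1 | exact: rmorphM]. Qed.

HB.instance Definition _ :=
  GRing.isZmodMorphism.Build _ _ _ scalar_conj_is_zmod_morphism.
HB.instance Definition _ :=
  GRing.isMonoidMorphism.Build _ _ _ scalar_conj_is_monoid_morphism.

Lemma scalar_normCK (x : F) : `|x| ^+ 2 = x * scalar_conj x.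
Proof. by case: k x => x; [rewrite real_normK ?num_real|apply: normCK]. Qed.

Lemma scalar_norm_conj (x : F) : `|scalar_conj x| = `|x|.
Proof. by case: k x => x //; exact: norm_conjC. Qed.

Lemma scalar_archimedean (x : F) : 0 <= x -> exists n, x < n%:R.
Proof.
case: k x => /= x x0; first by exists (Num.bound x); exact: archi_boundP.
exists (Num.bound (complex.Re x)).
rewrite -[x]RRe_real ?ger0_real// -(rmorph_nat (real_complex R)) ltcR.
by apply: archi_boundP; rewrite -lecR RRe_real// ger0_real.
Qed.

Lemma scalar_inv_nat_lt (e : F) : 0 < e ->
  exists N, forall n, (N <= n)%N -> n.+1%:R^-1 < e.
Proof.
move=> e0; have [N eN] : exists N, e^-1 < N%:R.
  by apply: scalar_archimedean; rewrite invr_ge0 ltW.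
exists N => n Nn; rewrite invf_plt ?posrE ?ltr0Sn//.
by apply: lt_le_trans eN _; rewrite ler_nat leqW.
Qed.

(** The order of the complex numbers is partial, but nonnegative numbers are
    real, so the infimum can be taken on the real parts. *)
Lemma scalar_inf (S : set F) : S !=set0 -> (forall x, S x -> 0 <= x) ->
  exists m, (forall x, S x -> m <= x) /\
            (forall e, 0 < e -> exists2 x, S x & x < m + e).
Proof.
case: k S => /= S [s Ss] S0.
  have lbS : has_lbound S by exists 0 => x /S0.
  exists (inf S); split=> [x Sx|e e0]; first exact: ge_inf.
  by apply: inf_adherent => //; split => //; exists s.
have ReS x : S x -> ((complex.Re x)%:C)%C = x.
  by move=> /S0 x0; rewrite RRe_real// ger0_real.
have lbS : has_lbound (@complex.Re R @` S).
  by exists 0 => _ [x Sx <-]; rewrite -lecR ReS// S0.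
exists ((inf (@complex.Re R @` S))%:C)%C; split=> [x Sx|e e0].
  by rewrite -[x]ReS// lecR; apply: ge_inf => //; exists x.
have eE : ((complex.Re e)%:C)%C = e by rewrite RRe_real// gtr0_real.
have [||_ [x Sx <-] xlt] := @inf_adherent _ (@complex.Re R @` S) (complex.Re e).
- by rewrite -ltcR eE.
- by split => //; exists (complex.Re s), s.
by exists x => //; rewrite -eE -rmorphD -[x]ReS// ltcR.
Qed.

End Scalars.

Lemma sqr_normD_le (F : numFieldType) (a b : F) :
  `|a + b| ^+ 2 <= 2 * (`|a| ^+ 2 + `|b| ^+ 2).
Proof.
apply: (@le_trans _ _ ((`|a| + `|b|) ^+ 2)).
  by rewrite ler_sqr ?nnegrE ?addr_ge0// ler_normD.
rewrite -subr_ge0 (_ : _ - _ = (`|a| - `|b|) ^+ 2); last by ring.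
by rewrite real_exprn_even_ge0// realB// normr_real.
Qed.

Lemma mul_div_succ_le (F : numFieldType) (e c : F) : 0 < e -> 0 <= c ->
  c * (e / (c + 1)) <= e.
Proof.
move=> e0 c0; rewrite mulrCA ger_pMr//.
by rewrite ler_pdivrMr ?ltr_wpDl// mul1r lerDl.
Qed.

Lemma exists_sqr_le (F : numFieldType) (e : F) : 0 < e ->
  exists2 d : F, 0 < d & d ^+ 2 <= e.
Proof.
move=> e0; have e1 : 0 < 1 + e by rewrite addr_gt0.
have d0 : 0 < e / (1 + e) by rewrite divr_gt0.
exists (e / (1 + e)) => //; rewrite expr2 (@le_trans _ _ (e / (1 + e)))//.
  by rewrite ger_pMr// ler_pdivrMr// mul1r lerDr.
by rewrite ler_pdivrMr// ler_peMr ?lerDl ?(ltW e0).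
Qed.

Lemma exists_common_le (F : numFieldType) (a b : F) : 0 < a -> 0 < b ->
  exists c, [/\ 0 < c, c <= a & c <= b].
Proof.
move=> a0 b0; have ab : 0 < a + b by rewrite addr_gt0.
exists (a * b / (a + b)); split; first by rewrite divr_gt0// mulr_gt0.
- by rewrite ler_pdivrMr// ler_pM2l// lerDr ltW.
- by rewrite ler_pdivrMr// mulrC ler_pM2l// lerDl ltW.
Qed.

(** * The projection theorem *)

Section DotForms.
Variables (R : realType) (k : scalar_kind).
Local Notation F := (scalars R k).
Variables (V : lmodType F) (f : {dot V for @scalar_conj R k}).
Local Notation "''[' u , v ]" := (f u%R v%R) : ring_scope.
Local Notation "''[' u ]" := '[u, u]%R : ring_scope.

Lemma dot_ge0 u : 0 <= '[u].
Proof.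
by have [->|u0] := eqVneq u 0; [rewrite linear0r | rewrite ltW ?neq0_dnorm_gt0].
Qed.

Lemma dot_eq0 u : '[u] = 0 -> u = 0.
Proof.
move=> u0; apply/eqP; apply: contraT => /neq0_dnorm_gt0 => /(_ _ f).
by rewrite u0 ltxx.
Qed.

Lemma dotC u v : '[u, v] = scalar_conj '[v, u].
Proof. by rewrite (hermC f) expr0 mul1r. Qed.

Lemma dot_normC u v : `|'[u, v]| = `|'[v, u]|.
Proof. by rewrite dotC scalar_norm_conj. Qed.

Lemma dotN u : '[- u] = '[u]. Proof. exact: (hnormN f). Qed.

Lemma dotBC u v : '[u - v] = '[v - u].
Proof. by rewrite -dotN opprB. Qed.

Lemma dot_parallelogram u v : '[u - v] + '[u + v] = 2 * ('[u] + '[v]).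
Proof. by rewrite !(linearDl, linearDr, linearNl, linearNr) /=; ring. Qed.

Lemma dot_double u : '[u + u] = 4 * '[u].
Proof. by rewrite !(linearDl, linearDr) /=; ring. Qed.

(** The residue of [u] after projection on the line of [v]: its nonnegativity is
    the Cauchy-Schwarz inequality, and in [dot_separation] its lower bound by the
    distance makes almost minimizers almost orthogonal. *)
Lemma dot_reduce u v : '[v] != 0 ->
  '[u - ('[u, v] / '[v]) *: v] = '[u] - `|'[u, v]| ^+ 2 / '[v].
Proof.
move=> v0; set t := _ / _.
have uv0 : '[u - t *: v, v] = 0.
  by rewrite linearBl /= linearZl_LR /= /t divfK// subrr.
rewrite linearBr /= linearZr_LR /= uv0 mulr0 subr0 linearBl /= linearZl_LR /=.
by rewrite scalar_normCK (dotC v u) /t mulrAC.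
Qed.

Lemma dot_CauchySchwarz u v : `|'[u, v]| ^+ 2 <= '[u] * '[v].
Proof.
have [v0|v0] := eqVneq '[v] 0.
  by rewrite (dot_eq0 v0) linear0r normr0 expr0n /= linear0r mulr0.
have := dot_ge0 (u - ('[u, v] / '[v]) *: v).
by rewrite dot_reduce// subr_ge0 ler_pdivrMr// lt_def v0 dot_ge0.
Qed.

(** Stated with the form alone, since the norm carried by the type of a product
    of Hilbert spaces is the max norm, not the one of the Hilbert sum. *)
Definition dot_complete : Prop := forall u : nat -> V,
  (forall e, 0 < e -> exists N, forall n m, (N <= n)%N -> (N <= m)%N ->
     '[u n - u m] < e) ->
  exists l, forall e, 0 < e -> exists N, forall n, (N <= n)%N -> '[u n - l] < e.

Hypothesis f_complete : dot_complete.

(** A minimizing sequence [g] for the distance from [p] to the subspace [G] is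
    Cauchy by the parallelogram identity; the vector from [p] to its limit [l] is
    orthogonal to [G].  It pairs nontrivially with [p]: otherwise it would be
    orthogonal to itself, and [p] would be a limit of points of [G]. *)
Lemma dot_separation (G : set V) (p : V) : G 0 ->
    (forall a u v, G u -> G v -> G (a *: u + v)) ->
    ~ (forall e, 0 < e -> exists2 g, G g & '[g - p] < e) ->
  exists q, (forall g, G g -> '[g, q] = 0) /\ '[p, q] <> 0.
Proof.
move=> G0 Glin Gp.
have [||m [m_lb m_inf]] := @scalar_inf R k [set '[g - p] | g in G].
- by exists '[0 - p], 0.
- by move=> _ [g _ <-]; exact: dot_ge0.
have /choice[g gP] n : exists g, G g /\ '[g - p] < m + n.+1%:R^-1.
  have /m_inf[_ [g Gg <-] ?] : 0 < (n.+1%:R^-1 : F) by rewrite invr_gt0 ltr0Sn.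
  by exists g.
have Gm h : G h -> m <= '[h - p] by move=> Gh; apply: m_lb; exists h.
have mid h1 h2 : G h1 -> G h2 -> 4 * m <= '[(h1 - p) + (h2 - p)].
  move=> Gh1 Gh2; pose h := 2^-1 *: h1 + (2^-1 *: h2 + 0).
  have -> : (h1 - p) + (h2 - p) = (h - p) + (h - p).
    rewrite addrACA [RHS]addrACA; congr (_ + _).
    by rewrite -mulr2n -scaler_nat /h addr0 -scalerDr scalerA divff ?scale1r ?pnatr_eq0.
  rewrite dot_double ler_pM2l ?ltr0n//; apply: Gm.
  by apply: (Glin) => //; apply: (Glin).
have [|l gl] := f_complete (u := g).
  move=> e e0; have /scalar_inv_nat_lt[N Ne] : 0 < e / 4 by rewrite divr_gt0.
  exists N => i j Ni Nj.
  have -> : g i - g j = (g i - p) - (g j - p) by rewrite opprB addrA subrK.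
  rewrite -(addrK '[(g i - p) + (g j - p)] '[_ - _]) dot_parallelogram.
  have gt_e n : (N <= n)%N -> '[g n - p] < m + e / 4.
    by move=> Nn; apply: lt_trans (gP n).2 _; rewrite ltrD2l Ne.
  apply: le_lt_trans (lerB (lexx _) (mid _ _ (gP i).1 (gP j).1)) _.
  rewrite ltrBlDr.
  apply: (@lt_le_trans _ _ (2 * ((m + e / 4) + (m + e / 4)))).
    by rewrite ltr_pM2l// ltrD// gt_e.
  by rewrite le_eqVlt; apply/orP; left; apply/eqP; field.
(* Moving from [g n] by the best multiple of [h] cannot beat the infimum [m]. *)
have approx_orth n h : G h -> `|'[g n - p, h]| ^+ 2 <= '[h] * n.+1%:R^-1.
  move=> Gh; have [h0|h0] := eqVneq '[h] 0.
    by rewrite (le_trans (dot_CauchySchwarz _ _))// h0 mulr0 mul0r.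
  have hgt0 : 0 < '[h] by rewrite lt_def h0 dot_ge0.
  rewrite mulrC -ler_pdivrMr//.
  have := dot_reduce (g n - p) h0; set t := _ / '[h].
  have : m <= '[g n - p - t *: h].
    rewrite addrAC; apply: Gm; rewrite addrC -scaleNr; apply: Glin => //.
    exact: (gP n).1.
  move=> + E; rewrite E lerBrDr -lerBrDl => /le_trans -> //.
  by rewrite lerBlDl ltW// (gP n).2.
pose q := l - p.
have orth h : G h -> '[q, h] = 0.
  move=> Gh; apply/eqP; rewrite -normr_le0 -(ler_sqr) ?nnegrE// expr0n /=.
  apply/ler_addgt0Pr => e e0; rewrite add0r.
  pose c := '[h] + 1; have e40 : 0 < e / 4 by rewrite divr_gt0.
  have ec : 0 < e / 4 / c by rewrite divr_gt0// ltr_wpDl// dot_ge0.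
  have [N Ne] := scalar_inv_nat_lt ec; have [M Me] := gl _ ec.
  pose n := maxn N M.
  have -> : q = (g n - p) - (g n - l) by rewrite opprB [RHS]addrC addrA subrK.
  rewrite linearBl/=; apply: le_trans (sqr_normD_le _ _) _; rewrite normrN.
  apply: (@le_trans _ _ (2 * ('[h] * (e / 4 / c) + '[h] * (e / 4 / c)))).
    rewrite ler_pM2l// lerD//.
      apply: le_trans (approx_orth n h Gh) _.
      by rewrite ler_wpM2l ?dot_ge0// ltW// Ne// leq_maxl.
    apply: le_trans (dot_CauchySchwarz _ _) _.
    by rewrite mulrC ler_wpM2l ?dot_ge0// ltW// Me// leq_maxr.
  apply: (@le_trans _ _ (2 * (e / 4 + e / 4))).
    by rewrite ler_pM2l// lerD// mul_div_succ_le// dot_ge0.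
  by rewrite le_eqVlt; apply/orP; left; apply/eqP; field.
have orthr h : G h -> '[h, q] = 0.
  by move=> /orth; rewrite (dotC h) => ->; rewrite rmorph0.
exists q; split => // pq0; apply: Gp.
suff q0 : q = 0.
  move=> e e0; have [N Ne] := gl _ e0; exists (g N); first exact: (gP N).1.
  by have /subr0_eq <- := q0; exact: Ne.
apply: dot_eq0; apply/eqP; rewrite eq_le dot_ge0 andbT.
apply/ler_addgt0Pr => e e0; rewrite add0r.
have [->|qn0] := eqVneq '[q] 0; first exact: ltW.
have qgt0 : 0 < '[q] by rewrite lt_def qn0 dot_ge0.
have [N Ne] := gl _ e0.
have qE : '[q] = '[l - g N, q].
  by rewrite {1}/q !linearBl/= pq0 (orthr (g N) (gP N).1).
apply: le_trans (ltW (Ne N (leqnn N))).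
have := dot_CauchySchwarz (l - g N) q; rewrite -qE.
by rewrite ger0_norm ?dot_ge0// expr2 ler_pM2r// (dotBC l (g N)).
Qed.

End DotForms.

(** * Hilbert spaces and their Hilbert sums *)

Lemma norm_cauchy_cvg (F : numFieldType) (V : completeNormedModType F)
    (u : nat -> V) :
  (forall e, 0 < e -> exists N, forall n m, (N <= n)%N -> (N <= m)%N ->
     `|u n - u m| < e) ->
  exists l, forall e, 0 < e -> exists N, forall n, (N <= n)%N -> `|u n - l| < e.
Proof.
move=> uC; have : cvg (u @ \oo).
  apply: cauchy_cvg; apply: cauchy_exP => e /uC[N uN]; exists (u N), N => // n /=.
  by move=> Nn; rewrite -ball_normE /=; apply: uN.
move=> /cvg_ex[l /cvgrPdist_lt ul]; exists l => e /ul[N _ uN]; exists N => n Nn.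
by rewrite distrC; exact: uN.
Qed.

Section HilbertSum.
Variables (R : realType) (k : scalar_kind).
Local Notation F := (scalars R k).

Lemma inner_lt_sqr (X : hilbertType R k) (x : X) (e : F) : 0 < e ->
  (inner x x < e ^+ 2) = (`|x| < e).
Proof. by move=> e0; rewrite -sqr_norm_inner ltr_pXn2r// nnegrE// ltW. Qed.

Lemma inner_complete (X : hilbertType R k) : dot_complete (@inner R k X).
Proof.
move=> u uC; have [|l ul] := @norm_cauchy_cvg _ X u.
  move=> e e0; have /uC[N uN] : 0 < e ^+ 2 by rewrite exprn_gt0.
  by exists N => n m Nn Nm; rewrite -inner_lt_sqr// uN.
exists l => e /exists_sqr_le[d d0 de]; have [N uN] := ul _ d0; exists N => n Nn.
by apply: lt_le_trans de; rewrite inner_lt_sqr// uN.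
Qed.

Lemma inner_norm_le (X : hilbertType R k) (x y : X) :
  `|inner x y| <= `|x| * `|y|.
Proof.
rewrite -ler_sqr ?nnegrE ?mulr_ge0// exprMn !sqr_norm_inner.
exact: dot_CauchySchwarz.
Qed.

Variables (X Y : hilbertType R k).

(** The form is equipped with the structure of an inner product below, so that
    [dot_separation] applies to linear relations. *)
Definition hsum_inner (p q : X * Y) : F := inner p.1 q.1 + inner p.2 q.2.

Let hsum_zmodl q : zmod_morphism (hsum_inner ^~ q).
Proof. by move=> u v; rewrite /hsum_inner !linearBl /=; ring. Qed.

Let hsum_zmodr p : zmod_morphism (hsum_inner p).
Proof. by move=> u v; rewrite /hsum_inner !linearBr /=; ring. Qed.

Let hsum_scalel q : scalable_for *%R (hsum_inner ^~ q).
Proof. by move=> a u; rewrite /hsum_inner !linearZl_LR /= mulrDr. Qed.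

Let hsum_scaler p : scalable_for (@scalar_conj R k \; *%R) (hsum_inner p).
Proof. by move=> a u; rewrite /hsum_inner !linearZr_LR /= mulrDr. Qed.

Let hsum_hermitian p q :
  hsum_inner p q = (-1) ^+ false * scalar_conj (hsum_inner q p).
Proof.
by rewrite /hsum_inner expr0 mul1r rmorphD /= -!dotC.
Qed.

Let hsum_pos p : p != 0 -> 0 < hsum_inner p p.
Proof.
case: p => x y; rewrite -[0]/(0, 0) xpair_eqE negb_and => /orP[] n0.
  by rewrite ltr_pwDl ?dot_ge0// neq0_dnorm_gt0.
by rewrite ltr_pwDr ?dot_ge0// neq0_dnorm_gt0.
Qed.

HB.instance Definition _ := @isBilinear.Build F _ _ _ _ _ hsum_inner
  hsum_zmodl hsum_zmodr hsum_scalel hsum_scaler.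
HB.instance Definition _ := @isHermitianSesquilinear.Build F _ _ _ hsum_inner
  hsum_hermitian.
HB.instance Definition _ := @isDotProduct.Build F _ hsum_inner hsum_pos.

Lemma hsum_complete : dot_complete hsum_inner.
Proof.
move=> u uC.
have [|l1 l1P] := @inner_complete X (fun n => (u n).1).
  move=> e /uC[N uN]; exists N => n m Nn Nm; apply: le_lt_trans (uN n m Nn Nm).
  by rewrite lerDl dot_ge0.
have [|l2 l2P] := @inner_complete Y (fun n => (u n).2).
  move=> e /uC[N uN]; exists N => n m Nn Nm; apply: le_lt_trans (uN n m Nn Nm).
  by rewrite lerDr dot_ge0.
exists (l1, l2) => e e0; have e20 : 0 < e / 2 by rewrite divr_gt0.
have [N1 N1P] := l1P _ e20; have [N2 N2P] := l2P _ e20.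
exists (maxn N1 N2) => n; rewrite geq_max => /andP[n1 n2].
by rewrite [ltRHS](splitr e) ltrD ?N1P ?N2P.
Qed.

End HilbertSum.

(** * Closures and rows of linear relations *)

Section ClosureAlgebra.
Context {K : numFieldType}.

Lemma linear_relation_closure {X Y : normedModType K} (A : set (X * Y)) :
  linear_relation A -> linear_relation (closure A).
Proof.
move=> [A0 Alin]; split=> [|a u v Au Av B]; first exact: subset_closure.
have : (fun z : (X * Y) * (X * Y) => a *: z.1 + z.2) z @[z --> (u, v)] -->
       a *: u + v.
  by apply: cvgD; [apply: cvgZ; [exact: cvg_cst | exact: cvg_fst] | exact: cvg_snd].
move=> /[apply] -[[U1 U2] /= [/Au[x [Ax U1x]] /Av[y [Ay U2y]]] UB].
by exists (a *: x + y); split; [exact: Alin | exact: (UB (x, y))].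
Qed.

Lemma mul_closure0_closable {X Y : normedModType K} (A : set (X * Y)) :
  linear_relation A -> (forall y, closure A (0, y) -> y = 0) -> closable A.
Proof.
move=> /linear_relation_closure Alin mulA; split => //; apply/seteqP.
by split=> [y /mulA//|_ ->]; exact: Alin.1.
Qed.

Lemma closable_mul0 {X Y : normedModType K} (A : set (X * Y)) y :
  closable A -> closure A (0, y) -> y = 0.
Proof. by move=> [_ mulA] Ay; have : relmul (closure A) y by []; rewrite mulA. Qed.

Lemma linear_relation_row {X1 X2 Y : lmodType K} (A1 : set (X1 * Y))
    (A2 : set (X2 * Y)) :
  linear_relation A1 -> linear_relation A2 -> linear_relation (relrow A1 A2).
Proof.
move=> [A10 A1lin] [A20 A2lin]; split.
  by exists 0, 0, 0, 0; split => //; rewrite addr0.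
move=> a _ _ [h1 [h2 [k1 [k2 [Ah1 Ah2 ->]]]]] [g1 [g2 [l1 [l2 [Ag1 Ag2 ->]]]]].
exists (a *: h1 + g1), (a *: h2 + g2), (a *: k1 + l1), (a *: k2 + l2); split.
- exact: (A1lin a _ _ Ah1 Ag1).
- exact: (A2lin a _ _ Ah2 Ag2).
- by congr (_, _); rewrite /= scalerDr addrACA.
Qed.

End ClosureAlgebra.

(** * Uniform boundedness *)

Section UniformBoundedness.
Variables (R : realType) (k : scalar_kind).
Local Notation F := (scalars R k).

(** If the functionals [inner^~ (a n)] were unbounded on every ball, shrinking
    closed balls, the [j]-th of which has some functional at least [j] on all of
    it, would meet in a point where the sequence is unbounded.  If they are
    bounded on one ball, evaluating at a multiple of [a n] bounds [`|a n|]. *)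
Lemma uniform_boundedness (H : hilbertType R k) (a : nat -> H) :
  (forall x, exists M, forall n, `|inner x (a n)| <= M) ->
  exists M, forall n, `|a n| <= M.
Proof.
move=> pointwise.
have [[x [r [M [r0 bnd]]]]|unbounded] := pselect (exists x (r M : F), 0 < r /\
    forall z, `|z - x| <= r -> forall n, `|inner z (a n)| <= M).
  exists (2 * M / r) => n; rewrite ler_pdivlMr//.
  have [->|an0] := eqVneq (a n) 0.
    rewrite normr0 mul0r mulr_ge0// (le_trans _ (bnd x _ n))//.
    by rewrite subrr normr0 ltW.
  have an_gt0 : 0 < `|a n| by rewrite normr_gt0.
  pose u := (r / `|a n|) *: a n.
  have uE : inner u (a n) = r * `|a n|.
    by rewrite /u linearZl_LR /= -sqr_norm_inner expr2 mulrA divfK// gt_eqF.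
  have -> : `|a n| * r = `|inner (x + u) (a n) - inner x (a n)|.
    rewrite -linearBl /= addrAC subrr add0r uE mulrC ger0_norm//.
    by rewrite mulr_ge0// ltW.
  rewrite (le_trans (ler_normB _ _))// mulr_natl mulr2n lerD// bnd//.
    rewrite addrAC subrr add0r /u normrZ ger0_norm ?divr_ge0 ?(ltW r0)//.
    by rewrite divfK// gt_eqF.
  by rewrite subrr normr0 ltW.
exfalso.
(* The ball [p'] refines the ball [p]; a pair stands for centre and radius. *)
pose step (j : nat) (p p' : H * F) := 0 < p.2 ->
  [/\ 0 < p'.2, p'.2 <= j.+1%:R^-1,
      forall z, `|z - p'.1| <= p'.2 -> `|z - p.1| <= p.2 &
      exists n, forall z, `|z - p'.1| <= p'.2 -> j%:R <= `|inner z (a n)|].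
have ex_step j p : exists p', step j p p'.
  have [r0|nr0] := pselect (0 < p.2); last by exists p => /nr0.
  have r20 : 0 < p.2 / 2 by rewrite divr_gt0.
  have [z [n [zr jn]]] : exists z n, `|z - p.1| <= p.2 / 2 /\
      (j.+1%:R : F) < `|inner z (a n)|.
    apply: contrapT => none; apply: unbounded.
    exists p.1, (p.2 / 2), j.+1%:R; split => // z zr n.
    rewrite real_leNgt ?ger0_real//; apply/negP => jn.
    by apply: none; exists z, n.
  (* Within this distance of [z], the pairing with [a n] changes by at most one. *)
  have d0 : 0 < (`|a n| + 1)^-1 by rewrite invr_gt0 ltr_wpDl.
  have [r1 [r10 r1r r1d]] := exists_common_le r20 d0.
  have j0 : 0 < (j.+1%:R^-1 : F) by rewrite invr_gt0 ltr0Sn.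
  have [r' [r'0 r'r1 r'j]] := exists_common_le r10 j0.
  exists (z, r') => _; split => //= [y yz|].
    rewrite -(subrK z y) -addrA (le_trans (ler_normD _ _))//.
    rewrite [leRHS](splitr p.2) lerD//.
    by rewrite (le_trans yz)// (le_trans r'r1).
  exists n => y yz.
  have zyn : `|inner (z - y) (a n)| <= 1.
    rewrite (le_trans (inner_norm_le _ _))// distrC.
    apply: (@le_trans _ _ ((`|a n| + 1)^-1 * (`|a n| + 1))).
      rewrite ler_pM// ?lerDl//.
      by rewrite (le_trans yz)// (le_trans r'r1).
    by rewrite mulVf// gt_eqF// ltr_wpDl.
  rewrite -(lerD2r 1) natr1 ltW// (lt_le_trans jn)//.
  have -> : inner z (a n) = inner y (a n) + inner (z - y) (a n).
    by rewrite -linearDl /= addrC subrK.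
  by rewrite (le_trans (ler_normD _ _))// lerD2l.
have [s sP] := choice (fun p => ex_step p.1 p.2).
pose p := fix p n : H * F := if n is n'.+1 then s (n', p n') else (0, 1).
have pos n : 0 < (p n).2.
  by elim: n => [|n IHn] /=; [exact: ltr01 | have [] := sP (n, p n) IHn].
have nested n m z : (n <= m)%N -> `|z - (p m).1| <= (p m).2 ->
    `|z - (p n).1| <= (p n).2.
  move=> /subnKC <-; elim: (m - n)%N => [|i IHi]; first by rewrite addn0.
  rewrite addnS /= => zi; apply: IHi.
  by have [_ _ + _] := sP ((n + i)%N, p (n + i)%N) (pos _); exact.
have center n m : (n <= m)%N -> `|(p m).1 - (p n).1| <= (p n).2.
  by move=> nm; apply: (nested n m) => //; rewrite subrr normr0 ltW.
have [|l ul] := @norm_cauchy_cvg _ H (fun n => (p n).1).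
  move=> e e0; have [|N Ne] := @scalar_inv_nat_lt R k (e / 2).
    by rewrite divr_gt0.
  have rN : (p N.+1).2 < e / 2.
    by have [_ rN _ _] := sP (N, p N) (pos N); rewrite (le_lt_trans rN)// Ne.
  exists N.+1 => n m Nn Nm.
  have -> : (p n).1 - (p m).1 =
      ((p n).1 - (p N.+1).1) - ((p m).1 - (p N.+1).1).
    by rewrite opprB addrA subrK.
  rewrite (le_lt_trans (ler_normB _ _))// [ltRHS](splitr e) ltrD//.
    by rewrite (le_lt_trans (center _ _ Nn)).
  by rewrite (le_lt_trans (center _ _ Nm)).
have l_in n : `|l - (p n).1| <= (p n).2.
  apply/ler_addgt0Pr => e /ul[M Mu]; pose m := maxn n M.
  rewrite -(subrK (p m).1 l) -addrA (le_trans (ler_normD _ _))//.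
  rewrite [leRHS]addrC lerD//.
    by rewrite distrC ltW// Mu// leq_maxr.
  by rewrite center// leq_maxl.
have [M lM] := pointwise l.
have M0 : 0 <= M by exact: le_trans (lM 0%N).
have [j Mj] := scalar_archimedean M0.
have [_ _ _ [n /(_ l (l_in j.+1)) jn]] := sP (j, p j) (pos j).
by have := lt_le_trans Mj (le_trans jn (lM n)); rewrite ltxx.
Qed.

End UniformBoundedness.

(** * Adjoints and closability *)

Section Closability.
Variables (R : realType) (k : scalar_kind).
Local Notation F := (scalars R k).

Lemma reldom_adjoint_linear (X Y : hilbertType R k) (A : set (X * Y)) :
  reldom (adjoint A) 0 /\ forall (c : F) (u v : Y),
    reldom (adjoint A) u -> reldom (adjoint A) v ->
    reldom (adjoint A) (c *: u + v).
Proof.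
split; first by exists 0 => x y _ /=; rewrite !linear0r.
move=> c u v [u' Au] [v' Av]; exists (c *: u' + v') => x y Axy /=.
by rewrite !linearDr /= !linearZr_LR /= (Au x y)// (Av x y).
Qed.

(** A vector [(x', y')] orthogonal to [A] in the Hilbert sum is, up to a sign, an
    element [(y', - x')] of the adjoint.  So if [(0, y)] were separated from [A]
    by such a vector, [y] would not be orthogonal to [dom A*]. *)
Lemma orth_reldom_adjoint (X Y : hilbertType R k) (A : set (X * Y)) (y : Y) :
  linear_relation A -> (forall d, reldom (adjoint A) d -> inner y d = 0) ->
  closure A (0, y).
Proof.
move=> [A0 Alin] yorth; apply: contrapT => nA.
have [|q [qA]] := dot_separation (@hsum_complete _ _ X Y) (p := (0, y)) A0 Alin.
  move=> approx; apply: nA; apply/closure_hsumP => e e0.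
  have [|q Aq ?] := approx (e ^+ 2); first by rewrite exprn_gt0.
  by exists q.
apply; rewrite /= /hsum_inner linear0l add0r yorth//.
exists (- q.1) => x z /qA /=; rewrite /hsum_inner /= => /eqP.
by rewrite addrC addr_eq0 linearNr => /eqP ->.
Qed.

(** The orthogonal complement of [dom A*] lies in the multivalued part of the
    closure of [A], which is zero. *)
Lemma reldom_adjoint_dense (X Y : hilbertType R k) (A : set (X * Y)) :
  linear_relation A -> closable A -> forall v e, 0 < e ->
  exists2 d, reldom (adjoint A) d & `|d - v| < e.
Proof.
move=> Alin Acl v e e0; have [D0 Dlin] := reldom_adjoint_linear A.
apply: contrapT => nD.
have [|q [qD]] := dot_separation (@inner_complete _ _ Y) (p := v) D0 Dlin.
  move=> approx; apply: nD.
  have [|d Dd dv] := approx (e ^+ 2); first by rewrite exprn_gt0.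
  by exists d => //; rewrite -inner_lt_sqr.
suff -> : q = 0 by rewrite linear0r.
apply: (closable_mul0 Acl); apply: orth_reldom_adjoint => // d /qD dq.
by rewrite dotC dq rmorph0.
Qed.

Lemma closable_row_fst (H1 H2 K : hilbertType R k) (R1 : set (H1 * K))
    (R2 : set (H2 * K)) :
  linear_relation R1 -> linear_relation R2 ->
  closable (relrow R1 R2) -> closable R1.
Proof.
move=> R1lin [R20 _] rowcl; apply: mul_closure0_closable => // y R1y.
apply: (closable_mul0 rowcl); apply/closure_hsum3P => e e0.
move/closure_hsumP : R1y => /(_ e e0)[[h l] [R1hl hl]].
exists ((h, 0), l); split; first by exists h, 0, l, 0; split => //; rewrite addr0.
by rewrite /= subrr linear0r addr0.
Qed.

Lemma closable_row_snd (H1 H2 K : hilbertType R k) (R1 : set (H1 * K))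
    (R2 : set (H2 * K)) :
  linear_relation R1 -> linear_relation R2 ->
  closable (relrow R1 R2) -> closable R2.
Proof.
move=> [R10 _] R2lin rowcl; apply: mul_closure0_closable => // y R2y.
apply: (closable_mul0 rowcl); apply/closure_hsum3P => e e0.
move/closure_hsumP : R2y => /(_ e e0)[[h l] [R2hl hl]].
exists ((0, h), l); split; first by exists 0, h, 0, l; split => //; rewrite add0r.
by rewrite /= subrr linear0r add0r.
Qed.

Lemma closure_rowP (H1 H2 K : hilbertType R k) (R1 : set (H1 * K))
    (R2 : set (H2 * K)) (y : K) :
  closure (relrow R1 R2) (0, y) -> forall e, 0 < e -> exists h1 k1 h2 k2,
    [/\ R1 (h1, k1), R2 (h2, k2), `|h1| < e, `|h2| < e & `|k1 + k2 - y| < e].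
Proof.
move=> /closure_hsum3P rowy e e0.
have [_ [[h1 [h2 [k1 [k2 [R1k R2k ->]]]]] /=]] := rowy e e0.
rewrite !subr0 => sum_lt; exists h1, k1, h2, k2.
have h1_ge0 := dot_ge0 inner h1; have h2_ge0 := dot_ge0 inner h2.
have k_ge0 := dot_ge0 inner (k1 + k2 - y).
split; [exact: R1k | exact: R2k | | |].
- rewrite -(inner_lt_sqr h1 e0); apply: le_lt_trans sum_lt.
  by rewrite -addrA lerDl addr_ge0.
- rewrite -(inner_lt_sqr h2 e0); apply: le_lt_trans sum_lt.
  by rewrite addrAC lerDr addr_ge0.
- rewrite -(inner_lt_sqr _ e0); apply: le_lt_trans sum_lt.
  by rewrite lerDr addr_ge0.
Qed.

(** When [k1 + k2] converges, [k1] and [k2] could a priori blow up and cancel.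
    That the adjoint domains add up to the whole space is what bounds [k1]. *)
Lemma closable_row (H1 H2 K : hilbertType R k) (R1 : set (H1 * K))
    (R2 : set (H2 * K)) :
  linear_relation R1 -> linear_relation R2 ->
  closed [set y1 + y2 | y1 in reldom (adjoint R1) & y2 in reldom (adjoint R2)] ->
  closable R1 -> closable R2 -> closable (relrow R1 R2).
Proof.
move=> R1lin R2lin sum_closed R1cl R2cl.
have dense1 := reldom_adjoint_dense R1lin R1cl.
have sum_full d : exists d1 d2,
    [/\ reldom (adjoint R1) d1, reldom (adjoint R2) d2 & d = d1 + d2].
  suff [d1 D1 [d2 D2 <-]] : [set y1 + y2 | y1 in reldom (adjoint R1) &
      y2 in reldom (adjoint R2)] d by exists d1, d2.
  apply: sum_closed => B /nbhs_ballP[e /= e0 eB].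
  have [d1 D1 d1d] := dense1 d e e0; exists d1; split.
    by exists d1 => //; exists 0; rewrite ?addr0//; exact: (reldom_adjoint_linear R2).1.
  by apply: eB; rewrite -ball_normE /= distrC.
apply: mul_closure0_closable; first exact: linear_relation_row.
move=> y /closure_rowP rowy.
have /choice[s sP] n : exists s : (H1 * K) * (H2 * K), [/\ R1 s.1, R2 s.2,
    `|s.1.1| < n.+1%:R^-1, `|s.2.1| < n.+1%:R^-1 &
    `|s.1.2 + s.2.2 - y| < n.+1%:R^-1].
  have /rowy[h1 [k1 [h2 [k2 ?]]]] : 0 < (n.+1%:R^-1 : F).
    by rewrite invr_gt0 ltr0Sn.
  by exists ((h1, k1), (h2, k2)).
(* The adjoint of [R1] turns the pairing of [k1] with [d1] into one of [h1]; for
   [d2], write [k1] as [(k1 + k2) - k2] and use the adjoint of [R2] on [k2]. *)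
have pairing d1 d2 : reldom (adjoint R1) d1 -> reldom (adjoint R2) d2 ->
    exists2 C, 0 <= C & forall n,
      `|inner (s n).1.2 (d1 + d2) - inner y d2| <= C * n.+1%:R^-1.
  move=> [x1 D1] [x2 D2]; exists (`|x1| + `|x2| + `|d2|); first by rewrite !addr_ge0.
  move=> n; have [] := sP n; case: (s n) => -[h1 k1] [h2 k2] /= R1k R2k h1n h2n kn.
  have -> : inner k1 (d1 + d2) - inner y d2 =
      inner h1 x1 - inner h2 x2 + inner (k1 + k2 - y) d2.
    rewrite (D1 _ _ R1k) (D2 _ _ R2k) /= linearDr /= linearBl linearDl /=.
    by ring.
  rewrite (le_trans (ler_normD _ _))// !mulrDl lerD//.
    rewrite (le_trans (ler_normB _ _))// lerD//;
    by rewrite (le_trans (inner_norm_le _ _))// mulrC ler_wpM2l// ltW.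
  by rewrite (le_trans (inner_norm_le _ _))// mulrC ler_wpM2l// ltW.
have [|B Bbnd] := uniform_boundedness (a := fun n => (s n).1.2).
  move=> d; have [d1 [d2 [D1 D2 ->]]] := sum_full d.
  have [C C0 CP] := pairing _ _ D1 D2.
  exists (C + `|inner y d2|) => n.
  rewrite dot_normC -(subrK (inner y d2) (inner _ _)).
  rewrite (le_trans (ler_normD _ _))// lerD2r (le_trans (CP n))//.
  by rewrite ler_piMr// invf_le1 ?ler1n ?ltr0Sn.
apply: (closable_mul0 R2cl); apply: orth_reldom_adjoint => // d2 D2.
apply/eqP; rewrite -normr_le0; apply/ler_addgt0Pr => e e0; rewrite add0r.
have B0 : 0 <= B by exact: le_trans (Bbnd 0%N).
have e20 : 0 < e / 2 by rewrite divr_gt0.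
have b0 : 0 < e / 2 / (B + 1) by rewrite !divr_gt0// ltr_wpDl.
have [d1 D1] := dense1 (- d2) _ b0; rewrite opprK => d12.
have [C C0 CP] := pairing _ _ D1 D2.
have c0 : 0 < e / 2 / (C + 1) by rewrite !divr_gt0// ltr_wpDl.
have [n /(_ n (leqnn n)) nc] := scalar_inv_nat_lt c0.
rewrite -(subKr (inner (s n).1.2 (d1 + d2)) (inner y d2)).
rewrite (le_trans (ler_normB _ _))// [leRHS](splitr e) lerD//.
  rewrite (le_trans (inner_norm_le _ _))//.
  rewrite (le_trans _ (mul_div_succ_le e20 B0))// ler_pM// ltW//.
rewrite (le_trans (CP n))// (le_trans _ (mul_div_succ_le e20 C0))//.
by rewrite ler_wpM2l// ltW.
Qed.

End Closability.

Theorem corollary4p5 (R : realType) (k : scalar_kind) (H1 H2 K : hilbertType R k)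
    (R1 : set (H1 * K)) (R2 : set (H2 * K)) :
  is_operator R1 -> is_operator R2 ->
  (closable (relrow R1 R2) -> closable R1 /\ closable R2) /\
  (closed [set y1 + y2 | y1 in reldom (adjoint R1) & y2 in reldom (adjoint R2)] ->
   closable R1 -> closable R2 -> closable (relrow R1 R2)).
Proof.
move=> [R1lin _] [R2lin _]; split; last exact: closable_row.
by move=> rowcl; split;
  [exact: closable_row_fst rowcl | exact: closable_row_snd rowcl].
Qed.
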